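(* Let $f(z)=P(z)/q(z)$ be a rational $\mathbb{C}^{m\times m}$-valued Pick function in $d$ variables, where $P(z)$ (a $\mathbb{C}^{m\times m}$-valued polynomial) and $q(z)$ (a scalar polynomial) are coprime. If $$P_1(z)=[P(z)-P(\overline z)^{*}]/2i,\quad P_2(z)=[P(z)+P(\overline z)^{*}]/2,$$ $$q_1(z)=[q(z)-\overline{q(\overline z)}]/2i,\quad q_2(z)=[q(z)+\overline{q(\overline z)}]/2,$$ then $$g(z_0,z)=\frac{z_0P_1(z)+P_2(z)}{z_0q_1(z)+q_2(z)}$$ is a rational Cayley inner function of the Pick class in $d+1$ variables, i.e. $g\in\mathcal{IP}_{d+1}^{m\times m}$. Moreover, $g(i,z)=f(z)$.
   Context: $\Pi^d=\{z\in\mathbb{C}^d\mid \mathrm{Im}\,z_1>0,\ldots,\mathrm{Im}\,z_d>0\}$. The Pick class $\mathcal{P}_d^{m\times m}$ consists of the $\mathbb{C}^{m\times m}$-valued functions $f$ of $d$ variables holomorphic in $\Pi^d$ with $(f(z)-f(z)^{*})/2i\ge 0$ (positive semidefinite) for $z\in\Pi^d$; its members are called Pick functions. $^{*}$ is the Hermitian conjugate, and $\overline z=(\overline z_1,\ldots,\overline z_d)$. $\mathcal{IP}_d^{m\times m}$ is the subclass of rational functions in $\mathcal{P}_d^{m\times m}$ that are Cayley inner, i.e. take Hermitian matrix values almost everywhere on $\mathbb{R}^d$. A matrix polynomial $P$ and a scalar polynomial $q$ are coprime if no nonconstant scalar polynomial divides $q$ and all entries of $P$. *)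

(* Defs.v *)
From HB Require Import structures.
From mathcomp Require Import all_boot all_order all_algebra.
From mathcomp Require Import -(notations) mpoly.
From mathcomp Require Import all_classical all_reals all_analysis.
From mathcomp Require Import complex.

Set Implicit Arguments.
Unset Strict Implicit.
Unset Printing Implicit Defensive.

Import Order.TTheory GRing.Theory Num.Theory.
Import numFieldNormedType.Exports.

Local Open Scope classical_set_scope.
Local Open Scope ring_scope.
Local Open Scope sesquilinear_scope.

(* The topology and norm of [R[i]] as a one-dimensional space over itself, so
   that [differentiable] below means complex differentiable. *)
HB.instance Definition _ (R : realType) := NormedModule.copy R[i] R[i]^o.

Section Pick.
Variable R : realType.
Local Notation C := R[i].

Definition upper_halfplane d : set 'rV[C]_d := [set z | forall k, 0 < 'Im (z 0 k)].

Definition psdmx m (A : 'M[C]_m) :=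
  A \is hermsymmx /\ forall v : 'cV[C]_m, 0 <= (v ^t* *m A *m v) 0 0.

Definition pick_class d m (f : 'rV[C]_d -> 'M[C]_m) :=
  (forall z, upper_halfplane z -> differentiable f z) /\
  (forall z, upper_halfplane z -> psdmx ((2 * 'i)^-1 *: (f z - (f z) ^t*))).

Definition mpmx_eval d m (P : 'M[mpoly d C]_m) (z : 'rV[C]_d) : 'M[C]_m :=
  map_mx (meval (z 0)) P.

(* [f = P / q] as rational functions: the values of [f] on the zero set of [q]
   are not constrained, so that [f] may be extended there. *)
Definition is_quotient d m (f : 'rV[C]_d -> 'M[C]_m)
    (P : 'M[mpoly d C]_m) (q : mpoly d C) :=
  q != 0 /\ forall z : 'rV[C]_d, meval (z 0) q != 0 ->
    f z = (meval (z 0) q)^-1 *: mpmx_eval P z.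

Definition rational_mx d m (f : 'rV[C]_d -> 'M[C]_m) :=
  exists P q, is_quotient f P q.

Definition mpdvd d (p q : mpoly d C) := exists r, q = r * p.

Definition coprime_mx d m (P : 'M[mpoly d C]_m) (q : mpoly d C) :=
  forall r, mpdvd r q -> (forall i j, mpdvd r (P i j)) ->
    exists c : C, r = mpolyC d c.

(* Lebesgue null sets of R^d, by countable covers by boxes of arbitrarily small
   total volume. *)
Definition null_set d (A : set 'rV[R]_d) :=
  forall e : R, 0 < e -> exists a b : nat -> 'rV[R]_d,
    [/\ forall n k, a n 0 k <= b n 0 k,
        A `<=` \bigcup_n
          [set x : 'rV[R]_d | forall k, a n 0 k <= x 0 k <= b n 0 k] &
        (\sum_(0 <= n <oo) (\prod_(k < d) (b n 0 k - a n 0 k))%:E <= e%:E)%E].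

Definition cayley_inner d m (f : 'rV[C]_d -> 'M[C]_m) :=
  null_set [set x : 'rV[R]_d | f (map_mx (real_complex R) x) \isn't hermsymmx].

Definition inner_pick_class d m (f : 'rV[C]_d -> 'M[C]_m) :=
  [/\ pick_class f, rational_mx f & cayley_inner f].

End Pick.

(* Main.v *)
Require Import Defs.
From HB Require Import structures.
From mathcomp Require Import all_boot all_order all_algebra perm.
From mathcomp Require Import -(notations) mpoly.
From mathcomp Require Import all_classical all_reals all_analysis.
From mathcomp Require Import complex.
From mathcomp Require Import ring.

Set Implicit Arguments.
Unset Strict Implicit.
Unset Printing Implicit Defensive.

Import Order.TTheory GRing.Theory Num.Theory.
Import numFieldNormedType.Exports.

Local Open Scope ring_scope.
Local Open Scope sesquilinear_scope.

(** Write [q~] for the polynomial with conjugate coefficients, so that [q~ z] is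
    the conjugate of [q] at the conjugate point. The denominator of [g] is
    [((z0 + 'i) * q - (z0 - 'i) * q~) / (2 * 'i)], and [z0 - 'i] has smaller
    modulus than [z0 + 'i] for [z0] in the upper half-plane. The denominator is
    therefore nonzero as soon as [q] has no zeros and [`|q~| <= `|q|] in the
    poly-half-plane. The inequality follows from the absence of zeros
    ([norm_reflect_eval_le]): on a line with real base point and positive
    direction, [q] is a univariate polynomial with all its roots in the closed
    lower half-plane, and [q~] has the mirrored ones.

    Positivity needs no boundary values ([Im_extend_eval_ge0]). For a vector [v]
    let [p] be the polynomial [v^* P v]. That [p / q] has nonnegative imaginary
    part means that [p + l * q] has no zeros for [l] in the upper half-plane.
    The argument for denominators applies to this polynomial: if [N] and [D] are
    the numerator and the denominator of [v^* g v], then [N + l * D] has no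
    zeros either, which says that [N / D] has nonnegative imaginary part.

    What remains is that [q] has no zeros in the poly-half-plane
    ([denominator_stable]); here coprimality enters. As [f] is continuous, [P]
    vanishes with [q]. If [q] had zeros, then at one of them it would not vanish
    identically along some coordinate ([movable_zero]), and the root would
    persist when the other coordinates vary in a polydisc ([root_persistence]).
    Elimination of that coordinate leaves two cases ([elimination]): the entries
    of [P] and [q] have a common factor, by the Gauss lemma and the factoriality
    of polynomial rings ([mpoly_factorial]), or some nonzero polynomial in the
    other coordinates vanishes on the polydisc. Both are impossible.

    At real points the two parts of [P] are Hermitian and those of [q] are real,
    so that [g] is Hermitian there. *)

(** * Gauss lemma and factoriality of polynomial rings *)

Definition divides (A : comNzRingType) (a b : A) := exists c, b = c * a.

Definition prime_element (A : comUnitRingType) (p : A) :=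
  [/\ p != 0, p \isn't a GRing.unit &
      forall a b, divides p (a * b) -> divides p a \/ divides p b].

(** Unique factorisation in the form that the induction on the number of
    variables needs: the size [N] makes the splitting off of factors
    terminate, and irreducibles are replaced by prime elements. *)
Definition factorial_ring (A : comUnitRingType) := exists N : A -> nat,
  [/\ forall a b, a * b != 0 -> (N b <= N (a * b)%R)%N,
      forall a b, a * b != 0 -> a \isn't a GRing.unit ->
        (N b < N (a * b)%R)%N &
      forall a : A, a != 0 -> a \isn't a GRing.unit ->
        exists2 p : A, prime_element p & divides p a].

Lemma divides_trans (A : comNzRingType) (b a c : A) :
  divides a b -> divides b c -> divides a c.
Proof. by move=> [u ->] [v ->]; exists (v * u); rewrite mulrA. Qed.

Lemma dividesM (A : comNzRingType) (a b c : A) :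
  divides a b -> divides a (c * b).
Proof. by move=> [u ->]; exists (c * u); rewrite mulrA. Qed.

Lemma dividesD (A : comNzRingType) (a b c : A) :
  divides a b -> divides a c -> divides a (b + c).
Proof. by move=> [u ->] [v ->]; exists (u + v); rewrite mulrDl. Qed.

Lemma dividesN (A : comNzRingType) (a b : A) : divides a b -> divides a (- b).
Proof. by move=> [u ->]; exists (- u); rewrite mulNr. Qed.

Section GaussLemma.
Variable A : idomainType.
Implicit Types (a c : A) (p q h r : {poly A}).

(** A leading coefficient that is a multiple of [a] can be removed, and two
    leading coefficients that are not have a product that is not. *)
Lemma prime_polyC a : prime_element a -> prime_element a%:P.
Proof.
move=> [a0 aU pr_a]; split; first by rewrite polyC_eq0.
  apply: contra aU; rewrite poly_unitE => /andP[_].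
  by rewrite coefC eqxx.
move=> p q; move: {2}(size p + size q)%N (leqnn (size p + size q)) => n.
have dvd0 : divides a%:P 0 by exists 0; rewrite mul0r.
elim: n p q => [|n IH] p q.
  rewrite leqn0 addn_eq0 size_poly_eq0 => /andP[/eqP-> _] _; by left.
have step p' q' : (size p' + size q' <= n.+1)%N -> p' != 0 ->
    divides a (lead_coef p') -> divides a%:P (p' * q') ->
    divides a%:P p' \/ divides a%:P q'.
  move=> sz p0 [c lc] dvd; set k := (size p').-1.
  have ek : size p' = k.+1 by rewrite /k prednK // lt0n size_poly_eq0.
  set t := (c%:P * a%:P) * 'X^k.
  have dt : divides a%:P t by exists (c%:P * 'X^k); rewrite /t mulrAC.
  have szt : (size (p' - t)%R < size p')%N.
    rewrite ek ltnS; apply/leq_sizeP => j jk.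
    rewrite /t -polyCM -lc mul_polyC coefB coefZ coefXn.
    case: eqVneq => [->|ne]; first by rewrite mulr1 lead_coefE subrr.
    by rewrite mulr0 subr0 nth_default // ek ltn_neqAle eq_sym ne.
  have [] := IH (p' - t) q'.
  - by rewrite -ltnS (leq_trans _ sz) // ltn_add2r.
  - rewrite mulrBl; apply: dividesD => //; apply: dividesN.
    by rewrite mulrC; apply: dividesM.
  - by move=> dpt; left; rewrite -(subrK t p'); apply: dividesD.
  - by right.
move=> sz; have [->|p0] := eqVneq p 0; first by left.
have [->|q0] := eqVneq q 0; first by right.
move=> dvd; have [c ec] := dvd.
have : divides a (lead_coef p * lead_coef q).
  by exists (lead_coef c); rewrite -lead_coefM ec lead_coefM lead_coefC.
move=> /pr_a[] dl; first exact: step.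
have [] := step q p _ q0 dl _; first by rewrite addnC.
- by rewrite mulrC.
- by right.
- by left.
Qed.

(** The unit-content condition, without choosing a content. *)
Definition primitive h := forall a, divides a%:P h -> a \is a GRing.unit.

Hypothesis facA : factorial_ring A.

Lemma primitive_part p : p != 0 ->
  exists c h, [/\ c != 0, p = c *: h & primitive h].
Proof.
have [N [_ Nlt prim]] := facA.
move: {2}(N (lead_coef p)).+1 (ltnSn (N (lead_coef p))) => n.
elim: n p => // n IH p; rewrite ltnS => Np p0.
have [prp|] := pselect (primitive p).
  by exists 1, p; rewrite scale1r oner_eq0; split.
move=> /existsNP[a] /not_implyP[] [p' ep] /negP aU.
have a0 : a != 0 by apply: contraNneq p0 => a0; rewrite ep a0 mulr0.
have ep' : p = a *: p' by rewrite ep mulrC mul_polyC.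
have p'0 : p' != 0 by apply: contraNneq p0 => p'0; rewrite ep' p'0 scaler0.
have [] := IH p' _ p'0.
  apply: leq_trans Np; rewrite ep' lead_coefZ; apply: Nlt => //.
  by rewrite mulf_neq0 // lead_coef_eq0.
move=> c [h [c0 eh prh]]; exists (a * c), h; split => //.
  by rewrite mulf_neq0.
by rewrite ep' eh scalerA.
Qed.

(** The pseudo-divisibility [%|] over an integral domain is divisibility over
    its fraction field: it allows a constant denominator [c]. Each prime factor
    of [c] divides [k * h], hence [k] because [h] is primitive, and can be
    cancelled until [c] is a unit. *)
Lemma Gauss_primitive h p : primitive h -> h %| p -> divides h p.
Proof.
move=> prh /Pdiv.Idomain.dvdpP[[c k] /= c0 e].
have [N [_ Nlt prim]] := facA.
move: {2}(N c).+1 (ltnSn (N c)) => n.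
elim: n c k c0 e => // n IH c k c0 e; rewrite ltnS => Nc.
have [cU|cU] := boolP (c \is a GRing.unit).
  exists (c^-1 *: k); rewrite -scalerAl -e scalerA mulVr // scale1r //.
have [a pra [c' ec]] := prim c c0 cU.
have [a0 aU _] := pra.
have [_ _ /(_ k h)] := prime_polyC pra.
case.
- by exists (c' *: p); rewrite -e ec -scalerAl [p * _]mulrC mul_polyC scalerA.
- move=> [k' ek]; apply: (IH c' k').
  + by apply: contraNneq c0 => c'0; rewrite ec c'0 mul0r.
  + apply: (@mulfI _ a%:P); first by rewrite polyC_eq0.
    by rewrite mul_polyC scalerA [a * _]mulrC -ec e ek mulrA [_ * k']mulrC.
  + apply: leq_trans Nc; rewrite ec mulrC; apply: Nlt => //.
    by rewrite mulrC -ec.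
- by move=> /prh; rewrite (negbTE aU).
Qed.

(** Over the fraction field irreducibles are prime, by Bezout; the Gauss lemma
    brings the resulting divisibility back to the ring. *)
Lemma prime_irreducible h :
  primitive h -> irreducible_poly h -> prime_element h.
Proof.
move=> prh irr; have [h1 hirr] := irr; split.
- exact: irredp_neq0.
- by rewrite poly_unitE; case: eqP => // e1; rewrite e1 in h1.
- move=> a b [c e].
  have dvd : h %| a * b by rewrite e dvdp_mull.
  have [ha|ha] := boolP (h %| a); first by left; apply: Gauss_primitive.
  right; apply: Gauss_primitive => //.
  have co : coprimep h a.
    rewrite /coprimep; apply: contraNT ha => sz.
    have /eqp_dvdl <- := hirr _ sz (dvdp_gcdl h a).
    exact: dvdp_gcdr.
  by rewrite -(Gauss_dvdpr _ co).
Qed.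

(** A polynomial is either a multiple of a nonunit constant, or primitive; in
    the latter case a primitive factor of least degree is irreducible over the
    fraction field. *)
Lemma poly_factorial : factorial_ring {poly A}.
Proof.
have [N [Nle Nlt prim]] := facA.
exists (fun p => size p + N (lead_coef p))%N; split.
- move=> a b ab0; have /andP[a0 b0] : (a != 0) && (b != 0).
    by rewrite -negb_or -mulf_eq0.
  rewrite size_mul // lead_coefM; apply: leq_add.
    have : (0 < size a)%N by rewrite lt0n size_poly_eq0.
    by case: (size a) => //= k _; rewrite leq_addl.
  by apply: Nle; rewrite mulf_neq0 ?lead_coef_eq0.
- move=> a b ab0 aU; have : (a != 0) && (b != 0) by rewrite -negb_or -mulf_eq0.
  move=> /andP[a0 b0].
  have lab0 : lead_coef a * lead_coef b != 0.
    by rewrite mulf_neq0 ?lead_coef_eq0.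
  rewrite size_mul // lead_coefM.
  have [a1|a1] := ltnP 1 (size a).
    rewrite -addSn leq_add ?Nle //.
    by case: (size a) a1 => [|[|k]] //= _; rewrite addSn ltnS leq_addl.
  have ea := size1_polyC a1.
  have -> : size a = 1%N.
    by apply/eqP; rewrite eqn_leq a1 lt0n size_poly_eq0.
  rewrite add1n /= -addnS leq_add2l; apply: Nlt => //.
  apply: contra aU; rewrite ea lead_coefC => u.
  rewrite poly_unitE size_polyC coefC eqxx u andbT; apply/eqP.
  by case: eqP u => // ->; rewrite unitr0.
- move=> r; move: {2}(size r).+1 (ltnSn (size r)) => n.
  elim: n r => // n IH r; rewrite ltnS => sz r0 rU.
  have [prr|] := pselect (primitive r); last first.
    move=> /existsNP[a] /not_implyP[] dar /negP aU.
    have a0 : a != 0.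
      by apply: contraNneq r0 => a0; case: dar => c ->; rewrite a0 mulr0.
    have [p prp dpa] := prim a a0 aU.
    exists p%:P; first exact: prime_polyC.
    apply: divides_trans dar; case: dpa => c ->; exists c%:P.
    by rewrite polyCM.
  have r1 : (1 < size r)%N.
    rewrite ltnNge; apply: contra rU => /size1_polyC er.
    have u : r`_0 \is a GRing.unit by apply: prr; exists 1; rewrite mul1r.
    by rewrite er; apply: rmorph_unit.
  have [irr|] := pselect (irreducible_poly r).
    exists r; first exact: prime_irreducible.
    by exists 1; rewrite mul1r.
  move=> /not_andP[//|] /existsNP[q] /not_implyP[q1] /not_implyP[qr] nqr.
  have q0 : q != 0 by apply: contraNneq r0 => q0; rewrite q0 dvd0p in qr.
  have [c [h [c0 eq prh]]] := primitive_part q0.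
  have eqh : q %= h by rewrite eq eqp_scale.
  have hr : divides h r by apply: Gauss_primitive; rewrite // -(eqp_dvdl _ eqh).
  have h0 : h != 0 by apply: contraNneq q0 => h0; rewrite eq h0 scaler0.
  have [] := IH h.
  + rewrite -(eqp_size eqh) (leq_trans _ sz) // ltn_neqAle dvdp_leq // andbT.
    by apply/negP => sqr; apply: nqr; rewrite -dvdp_size_eqp.
  + done.
  + rewrite poly_unitE -(eqp_size eqh) (negbTE q1) //.
  + by move=> p prp /divides_trans/(_ hr); exists p.
Qed.

End GaussLemma.

Lemma factorial_ring_iso (A B : comUnitRingType) (f : {rmorphism A -> B})
    (g : {rmorphism B -> A}) :
  cancel f g -> cancel g f -> factorial_ring A -> factorial_ring B.
Proof.
move=> fK gK [N [Nle Nlt prim]].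
have g0 b : (g b == 0) = (b == 0) by rewrite -(can_eq gK) rmorph0.
have gU b : (g b \is a GRing.unit) = (b \is a GRing.unit).
  by apply/idP/idP => [/(rmorph_unit f)|/(rmorph_unit g)//]; rewrite gK.
exists (N \o g); split=> /=.
- by move=> a b; rewrite -g0 rmorphM; exact: Nle.
- by move=> a b; rewrite -g0 -gU rmorphM; exact: Nlt.
- move=> b; rewrite -g0 -gU => b0 bU; have [p [p0 pU pr] [c e]] := prim _ b0 bU.
  exists (f p); last by exists (f c); rewrite -rmorphM -e gK.
  split; [by rewrite -g0 fK|by rewrite -gU fK|].
  have gd x : divides p (g x) -> divides (f p) x.
    by move=> [y ey]; exists (f y); rewrite -rmorphM -ey gK.
  move=> x y [z ez]; have : divides p (g x * g y).
    by exists (g z); rewrite -rmorphM ez rmorphM fK.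
  by move=> /pr[] /gd; [left|right].
Qed.

(** * Elimination of the last variable *)

(** Over a domain the Bezout relation only holds up to a constant [c]. It is
    expressed through the morphisms that kill [s], since it serves to evaluate
    at common zeros. *)
Lemma seq_Bezout (A : idomainType) (s : seq {poly A}) :
  exists g : {poly A}, (forall p, p \in s -> g %| p) /\
  exists2 c : A, c != 0 & forall (B : comNzRingType)
    (phi : {rmorphism {poly A} -> B}),
    (forall p, p \in s -> phi p = 0) -> phi (c *: g) = 0.
Proof.
elim: s => [|x s [g [gs [c c0 phig]]]].
  exists 0; split=> //; exists 1; first exact: oner_neq0.
  by move=> B phi _; rewrite scaler0 rmorph0.
exists (gcdp x g); split.
  move=> p; rewrite in_cons => /orP[/eqP->|/gs]; first exact: dvdp_gcdl.
  exact/dvdp_trans/dvdp_gcdr.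
have [[u v] /= /eqpP[[c1 c2] /= /andP[c10 c20] e]] := Bezoutp x g.
exists (c * c2); first by rewrite mulf_neq0.
move=> B phi phi0; rewrite -scalerA -e.
have -> : c *: (c1 *: (u * x + v * g)) =
    (c1 *: (c *: u)) * x + (c1 *: v) * (c *: g).
  by rewrite !scalerDr -!scalerAl -scalerAr !scalerA [c * c1]mulrC.
rewrite rmorphD [phi (_ * x)]rmorphM [phi (_ * (c *: g))]rmorphM.
rewrite (phi0 x (mem_head _ _)).
rewrite phig ?mulr0 ?addr0 // => p ps.
by apply: phi0; rewrite in_cons ps orbT.
Qed.

(** The gcd over the fraction field either has positive degree, and then its
    primitive part is a common factor by the Gauss lemma, or is a constant,
    which the Bezout relation puts in the ideal generated by [s]. *)
Lemma elimination (A : idomainType) (s : seq {poly A}) (q : {poly A}) :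
    factorial_ring A -> q \in s -> q != 0 ->
  (exists2 r : {poly A}, r \isn't a GRing.unit &
     forall p, p \in s -> divides r p) \/
  (exists2 c : A, c != 0 & forall (B : comNzRingType)
     (phi : {rmorphism {poly A} -> B}),
     (forall p, p \in s -> phi p = 0) -> phi c%:P = 0).
Proof.
move=> facA qs q0; have [g [gs [c c0 phig]]] := seq_Bezout s.
have g0 : g != 0.
  by apply: contraNneq q0 => g0; move: (gs q qs); rewrite g0 dvd0p.
have [g1|g1] := ltnP 1 (size g).
  left; have [a [h [a0 eg prh]]] := primitive_part facA g0.
  have gh : g %= h by rewrite eg eqp_scale.
  exists h; last first.
    by move=> p /gs gp; apply: Gauss_primitive; rewrite // -(eqp_dvdl _ gh).
  rewrite poly_unitE -(eqp_size gh); apply/negP => /andP[/eqP sg _].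
  by rewrite sg in g1.
right; exists (c * g`_0).
  rewrite mulf_neq0 //; apply: contraNneq g0.
  by rewrite [X in X == 0](size1_polyC g1) => ->.
move=> B phi phi0; rewrite polyCM mul_polyC -(size1_polyC g1); exact: phig.
Qed.

(** * Multivariate polynomials as polynomials in the last variable *)

Lemma mpoly_rmorph_eq n (R : nzRingType) (S : comNzRingType)
    (f g : {rmorphism mpoly n R -> S}) :
  (forall c, f (mpolyC n c) = g (mpolyC n c)) ->
  (forall i, f (mpolyX R (mnm1 i)) = g (mpolyX R (mnm1 i))) -> f =1 g.
Proof.
move=> fgC fgX p; rewrite [p]mpolyE !rmorph_sum /=; apply: eq_bigr => u _.
rewrite -mul_mpolyC !rmorphM /= fgC; congr (_ * _).
rewrite mpolyXE_id !rmorph_prod; apply: eq_bigr => i _.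
by rewrite !rmorphXn fgX.
Qed.

Section LastVariable.
Variables (n : nat) (R : comNzRingType).
Local Notation widen := (widen_ord (leqnSn n)).

Lemma muniX_widen i :
  muni (mpolyX R (mnm1 (widen i))) = (mpolyX R (mnm1 i))%:P.
Proof.
rewrite /muni mmapX mmap1U; case: splitP => [j eq|j].
  by congr (mpolyX _ (mnm1 _))%:P; apply/val_inj => /=; rewrite -eq.
by rewrite ord1 /= addn0 => /eqP /=; rewrite ltn_eqF.
Qed.

Lemma muniX_max : muni (mpolyX R (mnm1 (ord_max : 'I_n.+1))) = 'X.
Proof.
rewrite /muni mmapX mmap1U; case: splitP => //; case=> j lt_jn /eqP /=.
by have := lt_jn; rewrite ltn_neqAle eq_sym => /andP[/negbTE->].
Qed.

Lemma ord_widen_max (i : 'I_n.+1) : i = ord_max \/ exists j, i = widen j.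
Proof.
have [lt_in|le_ni] := ltnP i n.
  by right; exists (Ordinal lt_in); apply: val_inj.
by left; apply: val_inj; apply/eqP; rewrite eqn_leq -ltnS ltn_ord.
Qed.

Lemma meval_muni (v : 'I_n.+1 -> R) (p : mpoly n.+1 R) :
  (map_poly (meval (v \o widen)) (muni p)).[v ord_max] = meval v p.
Proof.
pose phi : {rmorphism mpoly n.+1 R -> R} :=
  horner_eval (v ord_max) \o map_poly (meval (v \o widen)) \o (@muni n R).
apply: (mpoly_rmorph_eq (f := phi) (g := meval v)) => [c|i];
    rewrite /phi /= /horner_eval.
  by rewrite muniC map_polyC /= !mevalC hornerC.
rewrite mevalXU; have [->|[j ->]] := ord_widen_max i.
  by rewrite muniX_max map_polyX hornerX.
by rewrite muniX_widen map_polyC hornerC /= mevalXU.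
Qed.

Definition muni_inv : {rmorphism {poly mpoly n R} -> mpoly n.+1 R} :=
  horner_eval (mpolyX R (mnm1 ord_max)) \o map_poly (@mwiden n R).

Lemma mwidenXU i : mwiden (mpolyX R (mnm1 i)) = mpolyX R (mnm1 (widen i)).
Proof. by rewrite mwidenX mnmwiden1. Qed.

Lemma muniK : cancel (@muni n R) muni_inv.
Proof.
pose phi : {rmorphism mpoly n.+1 R -> mpoly n.+1 R} := muni_inv \o (@muni n R).
apply: (mpoly_rmorph_eq (f := phi) (g := idfun)) => [c|i];
    rewrite /phi /= /horner_eval.
  by rewrite muniC map_polyC /= mwidenC hornerC.
have [->|[j ->]] := ord_widen_max i.
  by rewrite muniX_max map_polyX hornerX.
by rewrite muniX_widen map_polyC hornerC /= mwidenXU.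
Qed.

Lemma muni_mwiden (a : mpoly n R) : muni (mwiden a) = a%:P.
Proof.
pose phi : {rmorphism mpoly n R -> {poly mpoly n R}} :=
  (@muni n R) \o (@mwiden n R).
apply: (mpoly_rmorph_eq (f := phi) (g := polyC)) => [c|i]; rewrite /phi /=.
  by rewrite mwidenC muniC.
by rewrite mwidenXU muniX_widen.
Qed.

Lemma muni_invK : cancel muni_inv (@muni n R).
Proof.
elim/poly_ind => [|p c IH]; first by rewrite !rmorph0.
rewrite !rmorphD !rmorphM /= {1}/horner_eval [X in X * _]IH.
rewrite /horner_eval map_polyX hornerX muniX_max map_polyC hornerC /=.
by rewrite muni_mwiden.
Qed.

End LastVariable.

(** The point [(y, t)], with [t] as last coordinate. *)
Definition snoc_point n (T : Type) (y : 'I_n -> T) (t : T) (i : 'I_n.+1) : T :=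
  oapp y t (unlift ord_max i).

Lemma snoc_point_max n (T : Type) (y : 'I_n -> T) (t : T) :
  snoc_point y t ord_max = t.
Proof. by rewrite /snoc_point unlift_none. Qed.

Lemma snoc_point_widen n (T : Type) (y : 'I_n -> T) (t : T) :
  snoc_point y t \o widen_ord (leqnSn n) = y.
Proof.
apply/funext => j; rewrite /snoc_point /=.
have -> : widen_ord (leqnSn n) j = lift ord_max j.
  by apply: val_inj; rewrite /= /bump leqNgt ltn_ord.
by rewrite liftK.
Qed.

Lemma mpoly0_const (R : comNzRingType) (p : mpoly 0 R) :
  p = mpolyC 0 (mcoeff mnm0 p).
Proof.
apply/mpolyP => u; rewrite mcoeffC; have -> : u = mnm0.
  by apply/mnmP => -[].
by rewrite eqxx mulr1.
Qed.

Lemma mpoly_factorial n (K : fieldType) : factorial_ring (mpoly n K).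
Proof.
elim: n => [|n IH].
  have unit_mpoly0 (p : mpoly 0 K) : p != 0 -> p \is a GRing.unit.
    rewrite [p]mpoly0_const.
    by rewrite mpolyC_eq0 => p0; apply: rmorph_unit; rewrite unitfE.
  exists (fun=> 0%N); split=> // [a b ab0 /negP[]|a a0 /negP[]].
    by apply: unit_mpoly0; apply: contraNneq ab0 => ->; rewrite mul0r.
  exact: unit_mpoly0.
apply: (factorial_ring_iso (f := muni_inv n K) (g := @muni n K)).
- exact: muni_invK.
- exact: muniK.
- exact: poly_factorial.
Qed.

Lemma meval_msym n (R : comNzRingType) (s : 'S_n) (p : mpoly n R) v :
  meval v (msym s p) = meval (v \o s) p.
Proof.
pose phi : {rmorphism mpoly n R -> R} := meval v \o msym s.
apply: (mpoly_rmorph_eq (f := phi) (g := meval (v \o s))) => [c|i];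
    rewrite /phi /=.
  by rewrite /msym mmapC !mevalC.
by rewrite /msym mmapX mmap1U !mevalXU.
Qed.

(** * Polynomials vanishing on polydiscs *)

(** [S] has enough points to detect the zero polynomial. *)
Definition line_dense (K : comNzRingType) (S : K -> Prop) :=
  forall p : {poly K}, (forall x, S x -> p.[x] = 0) -> p = 0.

Lemma mpoly_eq0_grid (K : comNzRingType) d (S : 'I_d -> K -> Prop)
    (p : mpoly d K) :
    (forall k, line_dense (S k)) ->
    (forall v, (forall k, S k (v k)) -> meval v p = 0) ->
  p = 0.
Proof.
elim: d S p => [|d IH] S p dS p0.
  have ep := mpoly0_const p.
  have p00 : meval (fun=> 0) p = 0 by apply: p0 => -[].
  by rewrite ep mevalC in p00; rewrite ep p00 raddf0.
apply: (can_inj (@muniK d K)); rewrite rmorph0.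
apply/polyP => j; rewrite coef0.
apply: (IH (fun k => S (widen_ord (leqnSn d) k))) => // v Sv.
rewrite -coef_map; suff -> : map_poly (meval v) (muni p) = 0 by rewrite coef0.
apply: (dS ord_max) => x Sx.
have := p0 (snoc_point v x).
rewrite -meval_muni snoc_point_max snoc_point_widen; apply=> k.
have [->|[i ->]] := ord_widen_max k; first by rewrite snoc_point_max.
have -> : snoc_point v x (widen_ord (leqnSn d) i) = v i.
  by rewrite -[RHS](congr1 (@^~ i) (snoc_point_widen v x)).
exact: Sv.
Qed.

Section PolyDiscs.
Variable K : numClosedFieldType.
Implicit Types (x e : K).

Lemma line_dense_ball x e : 0 < e -> line_dense (fun s => `|s - x| < e).
Proof.
move=> e0 p p0; apply: contraTeq isT => pn0.
(* the shift by two keeps the points strictly inside the ball *)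
pose pt (j : nat) : K := x + e / j.+2%:R.
have pt_inj : injective pt.
  move=> i j /addrI /(mulfI (lt0r_neq0 e0)) /invr_inj /eqP.
  by rewrite eqr_nat => /eqP[].
have : (size [seq pt j | j <- iota 0 (size p)] < size p)%N.
  apply: max_poly_roots => //; last by rewrite map_inj_uniq ?iota_uniq.
  apply/allP => _ /mapP[j _ ->]; apply/eqP/p0.
  rewrite /pt addrAC subrr add0r ger0_norm ?divr_ge0 ?ltW //.
  by rewrite ltr_pdivrMr ?ltr0n // -{1}[e]mulr1 ltr_pM2l // ltr1n.
by rewrite size_map size_iota ltnn.
Qed.

Lemma line_dense_sub (S T : K -> Prop) :
  (forall s, S s -> T s) -> line_dense S -> line_dense T.
Proof. by move=> ST dS p pT; apply: dS => s /ST; exact: pT. Qed.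

Lemma Im_gt0_ball x s : `|s - x| < 'Im x -> 0 < 'Im s.
Proof.
move=> sx; rewrite real_ltNge ?Creal_Im ?real0 //; apply/negP => s0.
have x0 : 0 < 'Im x by apply: le_lt_trans sx.
have : 'Im x ^+ 2 <= `|s - x| ^+ 2.
  rewrite distrC normC2_Re_Im; apply: (@le_trans _ _ ('Im (x - s) ^+ 2)).
    have le : 'Im x <= 'Im (x - s) by rewrite raddfB /= lerDl oppr_ge0.
    by rewrite ler_pXn2r ?nnegrE ?(ltW x0) // (le_trans (ltW x0)).
  by rewrite lerDr real_exprn_even_ge0 ?Creal_Re.
by rewrite ler_pXn2r ?nnegrE ?(ltW x0) // real_leNgt ?Creal_Im ?normr_real ?sx.
Qed.

Lemma line_dense_upper : line_dense (fun s : K => 0 < 'Im s).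
Proof.
apply: (@line_dense_sub (fun s => `|s - 'i| < 'Im 'i)) => [s|].
  exact: Im_gt0_ball.
by apply: line_dense_ball; rewrite Im_i ltr01.
Qed.

Lemma line_dense_upper_ball x e : 0 < 'Im x -> 0 < e ->
  line_dense (fun s => `|s - x| < e /\ 0 < 'Im s).
Proof.
move=> x0 e0; case: (real_leP (gtr0_real e0) (Creal_Im x)) => [ex|xe].
  apply: (@line_dense_sub (fun s => `|s - x| < e)); last exact: line_dense_ball.
  by move=> s sx; split=> //; apply: (@Im_gt0_ball x); apply: lt_le_trans ex.
apply: (@line_dense_sub (fun s => `|s - x| < 'Im x)).
  by move=> s sx; split; [apply: lt_trans xe|exact: Im_gt0_ball sx].
exact: line_dense_ball.
Qed.

(** If all roots are at distance at least [e] from [x], then moving from [x] to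
    [x + t] multiplies each linear factor by at most [1 + `|t| / e]. A
    polynomial without roots near [x] is thus controlled by its value at [x]
    alone. *)
Lemma no_root_growth (p : {poly K}) x e t : 0 < e ->
    (forall s, `|s - x| < e -> p.[s] != 0) ->
  `|p.[x + t]| <= `|p.[x]| * (1 + `|t| / e) ^+ size p.
Proof.
move=> e0 p0; have [r ep] := closed_field_poly_normal p.
have [lp0|lp0] := eqVneq (lead_coef p) 0.
  by rewrite ep lp0 scale0r !horner0 normr0 mul0r.
have far z : z \in r -> e <= `|x - z|.
  move=> zr; rewrite real_leNgt ?normr_real ?gtr0_real // distrC.
  apply/negP => /p0 /negP[]; rewrite -/(root p z).
  by rewrite ep rootZ // root_prod_XsubC.
have sr : (size r <= size p)%N by rewrite ep size_scale // size_prod_XsubC.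
have g1 : 1 <= 1 + `|t| / e by rewrite lerDl divr_ge0 // ltW.
apply: (@le_trans _ _ (`|p.[x]| * (1 + `|t| / e) ^+ size r)); last first.
  by apply: ler_wpM2l => //; apply: ler_weXn2l.
rewrite ep !hornerZ !normrM -mulrA; apply: ler_wpM2l => //.
rewrite !horner_prod !normr_prod.
elim: r far {ep sr} => [|z r IH] far; first by rewrite !big_nil mulr1.
rewrite !big_cons exprS mulrACA; apply: ler_pM => //.
- by apply: prodr_ge0.
- rewrite !hornerXsubC mulrDr mulr1 addrAC.
  apply: (le_trans (ler_normD _ _)); rewrite lerD2l mulrCA ler_peMr //.
  by rewrite ler_pdivlMr // mul1r far ?mem_head.
- by apply: IH => y yr; apply: far; rewrite in_cons yr orbT.
Qed.

End PolyDiscs.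

(** * Reflection of polynomials without zeros in the upper half-plane *)

Section Reflection.
Variable K : numClosedFieldType.

Lemma normC2_sub_conj (t z : K) :
  `|t - z^*| ^+ 2 = `|t - z| ^+ 2 + 'Im t * 'Im z *+ 4.
Proof.
rewrite !normC2_Re_Im !raddfB /= Re_conj Im_conj.
ring.
Qed.

(** Passing from [q] to its conjugate moves each root from the closed lower
    half-plane to its mirror image, which is nearer to [t]. *)
Lemma norm_reflect_le (q : {poly K}) :
    (forall t, 0 < 'Im t -> q.[t] != 0) ->
  forall t, 0 < 'Im t -> `|(map_poly Num.conj q).[t]| <= `|q.[t]|.
Proof.
move=> q0 t t0; have [r eq] := closed_field_poly_normal q.
have r0 z : z \in r -> 'Im z <= 0.
  move=> zr; rewrite real_leNgt ?Creal_Im ?real0 //.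
  apply/negP => /q0 /negP[]; rewrite eq -/(root _ z).
  have [->|l0] := eqVneq (lead_coef q) 0; first by rewrite scale0r root0.
  by rewrite rootZ // root_prod_XsubC.
rewrite eq map_polyZ rmorph_prod /= !hornerZ !normrM norm_conjC.
apply: ler_wpM2l => //; rewrite !horner_prod !normr_prod.
rewrite big_seq [leRHS]big_seq.
apply: ler_prod => z zr; rewrite normr_ge0 rmorphB /= map_polyX map_polyC /=.
rewrite !hornerXsubC -ler_sqr ?nnegrE ?normr_ge0 // normC2_sub_conj gerDl.
by rewrite mulrn_wle0 // mulr_ge0_le0 ?(ltW t0) ?r0.
Qed.

Lemma conjCNi : (- 'i)^* = 'i :> K.
Proof. by rewrite rmorphN /= conjCi opprK. Qed.

(** The left-hand side is [((z0 + 'i) * a - (z0 - 'i) * b) / (2 * 'i)], and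
    [z0 - 'i] is strictly smaller than [z0 + 'i]. *)
Lemma moebius_denominator_neq0 (z0 a b : K) :
    0 < 'Im z0 -> a != 0 -> `|b| <= `|a| ->
  z0 * ((a - b) / (2 * 'i)) + (a + b) / 2 != 0.
Proof.
move=> z00 a0 ba.
have i0 : 'i != 0 :> K := neq0Ci K.
have -> : z0 * ((a - b) / (2 * 'i)) + (a + b) / 2 =
    ((z0 + 'i) * a - (z0 - 'i) * b) / (2 * 'i).
  by field.
rewrite mulf_neq0 ?invr_neq0 ?mulf_neq0 ?pnatr_eq0 // subr_eq0.
apply/eqP => /(congr1 Num.norm); rewrite !normrM => e.
have lt : `|z0 - 'i| < `|z0 + 'i|.
  rewrite -ltr_sqr ?nnegrE ?normr_ge0 //.
  have := normC2_sub_conj z0 (- 'i); rewrite conjCNi opprK => ->.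
  by rewrite raddfN /= Im_i mulrN1 mulNrn ltrBlDr ltrDl mulrn_wgt0.
have : `|z0 - 'i| * `|b| < `|z0 + 'i| * `|a|.
  apply: (le_lt_trans (y := `|z0 - 'i| * `|a|)); first exact: ler_wpM2l.
  by rewrite ltr_pM2r // normr_gt0.
by rewrite e ltxx.
Qed.

Definition line_poly d (x y : 'I_d -> K) : mpoly d K -> {poly K} :=
  mmap polyC (fun k => (x k)%:P + y k *: 'X).

Lemma horner_line_poly d (x y : 'I_d -> K) p t :
  (line_poly x y p).[t] = meval (fun k => x k + t * y k) p.
Proof.
pose phi : {rmorphism mpoly d K -> K} :=
  horner_eval t \o mmap polyC (fun k => (x k)%:P + y k *: 'X).
apply: (mpoly_rmorph_eq (f := phi) (g := meval _)) => [c|i];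
    rewrite /phi /= /horner_eval.
  by rewrite mmapC hornerC mevalC.
by rewrite mmapX mmap1U mevalXU hornerD hornerC hornerZ hornerX mulrC.
Qed.

(** The value at [z] of the polynomial with conjugate coefficients. *)
Definition reflect_eval d (p : mpoly d K) (z : 'I_d -> K) : K :=
  (meval (fun k => (z k)^*) p)^*.

(** On the line through the real and imaginary parts of [(z, l)] the polynomial
    [p + l * q] becomes a univariate polynomial without zeros in the upper
    half-plane; the point [(z, l)] itself sits at parameter ['i]. The extra
    variable [l] serves to express positivity as absence of zeros. *)
Lemma norm_reflect_eval_le d (p q : mpoly d K) :
    (forall z l, (forall k, 0 < 'Im (z k)) -> 0 < 'Im l ->
       meval z p + l * meval z q != 0) ->
  forall z l, (forall k, 0 < 'Im (z k)) -> 0 < 'Im l ->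
    `|reflect_eval p z + l * reflect_eval q z| <= `|meval z p + l * meval z q|.
Proof.
move=> pq0 z l z0 l0.
pose x k := 'Re (z k); pose y k := 'Im (z k).
pose Q := line_poly x y p + (('Re l)%:P + 'Im l *: 'X) * line_poly x y q.
have QE t : Q.[t] = meval (fun k => x k + t * y k) p +
    ('Re l + t * 'Im l) * meval (fun k => x k + t * y k) q.
  rewrite /Q !hornerE !horner_line_poly; congr (_ + _ * _).
  by rewrite mulrC.
have Im_line (a : K) (b t : K) : 0 < 'Im t -> 0 < 'Im b ->
    0 < 'Im ('Re a + t * 'Im b).
  move=> t0 b0; rewrite raddfD /= ImMr ?Creal_Im //.
  by rewrite (Creal_ImP _ (Creal_Re a)) add0r mulr_gt0.
have Qi : Q.['i] = meval z p + l * meval z q.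
  rewrite QE -Crect.
  by congr (_ + _ * _); apply: meval_eq => k; rewrite [RHS]Crect.
have Qi' : (map_poly Num.conj Q).['i] =
    reflect_eval p z + l * reflect_eval q z.
  rewrite -[X in _.[X]]conjCNi horner_map QE rmorphD rmorphM /= /reflect_eval.
  have ec (u : K) : 'Re u + - 'i * 'Im u = u^*.
    by rewrite {3}[u]Crect conjC_rect ?Creal_Re ?Creal_Im // mulNr.
  rewrite ec conjCK; congr (_^* + _ * _^*); apply: meval_eq => k; exact: ec.
rewrite -Qi -Qi'; apply: norm_reflect_le; last by rewrite Im_i ltr01.
move=> t t0; rewrite QE; apply: pq0 => [k|]; exact: Im_line.
Qed.

(** The two halves of [a] and [b], recombined with [z0] in place of ['i].
    Scalars use [b := a]; for an off-diagonal entry [a] of a matrix, [b] is the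
    transposed entry. *)
Definition extend_eval d (a b : mpoly d K) (z0 : K) (z : 'I_d -> K) : K :=
  z0 * ((meval z a - reflect_eval b z) / (2 * 'i)) +
  (meval z a + reflect_eval b z) / 2.

Lemma extend_eval_neq0 d (q : mpoly d K) :
    (forall z, (forall k, 0 < 'Im (z k)) -> meval z q != 0) ->
  forall z0 z, 0 < 'Im z0 -> (forall k, 0 < 'Im (z k)) ->
    extend_eval q q z0 z != 0.
Proof.
move=> q0 z0 z z00 zz; apply: moebius_denominator_neq0; rewrite ?q0 //.
have := norm_reflect_eval_le (p := q) (q := 0) _ zz z00.
rewrite /reflect_eval !meval0 rmorph0 !mulr0 !addr0; apply => w l.
by rewrite meval0 mulr0 addr0 => /q0.
Qed.

(** A number [c] has nonnegative imaginary part iff [c + l] does not vanish for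
    any [l] in the upper half-plane. So the hypothesis says that [p + l * q] has
    no zeros, and the conclusion that its extension has none, which is the
    previous argument applied to [p + l * q]. *)
Lemma Im_extend_eval_ge0 d (p q : mpoly d K) :
    (forall z, (forall k, 0 < 'Im (z k)) -> meval z q != 0) ->
    (forall z, (forall k, 0 < 'Im (z k)) -> 0 <= 'Im (meval z p / meval z q)) ->
  forall z0 z, 0 < 'Im z0 -> (forall k, 0 < 'Im (z k)) ->
    0 <= 'Im (extend_eval p p z0 z / extend_eval q q z0 z).
Proof.
move=> q0 fge0 z0 z z00 zz.
have pq0 w l : (forall k, 0 < 'Im (w k)) -> 0 < 'Im l ->
    meval w p + l * meval w q != 0.
  move=> ww l0; rewrite -[meval w p](divfK (q0 _ ww)) -mulrDl.
  rewrite mulf_neq0 ?q0 //; apply/eqP => /(congr1 (fun u => 'Im u)).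
  rewrite raddf0 raddfD /= => e.
  have : 0 < 'Im (meval w p / meval w q) + 'Im l by rewrite ltr_wpDl ?fge0.
  by rewrite e ltxx.
have D0 := extend_eval_neq0 q0 z00 zz.
rewrite real_leNgt ?Creal_Im ?real0 //; apply/negP => g0.
set l := - (extend_eval p p z0 z / extend_eval q q z0 z).
have l0 : 0 < 'Im l by rewrite raddfN oppr_gt0.
have := norm_reflect_eval_le pq0 zz l0.
move=> /(moebius_denominator_neq0 z00 (pq0 z l zz l0)) /eqP; apply.
transitivity (extend_eval p p z0 z + l * extend_eval q q z0 z).
  rewrite /extend_eval; field.
  by rewrite neq0Ci.
by rewrite /l mulNr divfK // subrr.
Qed.

End Reflection.

(** * Differentiability of polynomial maps *)

Section Differentiability.
Variable R : realType.
Local Notation C := R[i].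

Lemma differentiable_meval d (p : mpoly d C) (z : 'rV[C]_d) :
  differentiable (fun w : 'rV[C]_d => meval (w 0) p) z.
Proof.
have -> : (fun w : 'rV[C]_d => meval (w 0) p) =
    fun w => \sum_(u <- msupp p) mcoeff u p * \prod_(i < d) w 0 i ^+ u i.
  by apply/funext => w; rewrite mevalE.
elim: (msupp p) => [|u s IH].
  have -> : (fun w : 'rV[C]_d => \sum_(u <- [::]) mcoeff u p *
       \prod_(i < d) w 0 i ^+ u i) = cst 0.
    by apply/funext => w; rewrite big_nil.
  exact: differentiable_cst.
have -> : (fun w : 'rV[C]_d => \sum_(u <- u :: s) mcoeff u p *
       \prod_(i < d) w 0 i ^+ u i) =
    (fun w => mcoeff u p * \prod_(i < d) w 0 i ^+ u i) \+
    (fun w => \sum_(u <- s) mcoeff u p * \prod_(i < d) w 0 i ^+ u i).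
  by apply/funext => w; rewrite big_cons.
apply: differentiableD => //.
apply: differentiableM; first exact: differentiable_cst.
elim: (index_enum _) => [|k r IHr].
  have -> : (fun w : 'rV[C]_d => \prod_(i <- [::]) w 0 i ^+ u i) = cst 1.
    by apply/funext => w; rewrite big_nil.
  exact: differentiable_cst.
have -> : (fun w : 'rV[C]_d => \prod_(i <- k :: r) w 0 i ^+ u i) =
    (fun w => w 0 k ^+ u k * \prod_(i <- r) w 0 i ^+ u i).
  by apply/funext => w; rewrite big_cons.
apply: differentiableM => //; elim: (u k) => [|n IHn].
  exact: differentiable_cst.
have -> : (fun w : 'rV[C]_d => w 0 k ^+ n.+1) =
    (fun w => w 0 k * w 0 k ^+ n).
  by apply/funext => w; rewrite exprS.
by apply: differentiableM => //; exact: differentiable_coord.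
Qed.

Lemma continuous_meval d (p : mpoly d C) :
  continuous (fun w : 'rV[C]_d => meval (w 0) p).
Proof. by move=> z; apply/differentiable_continuous/differentiable_meval. Qed.

Lemma differentiable_mx d m (F : 'rV[C]_d -> 'M[C]_m) z :
  (forall i j, differentiable (fun w => F w i j) z) -> differentiable F z.
Proof.
move=> dF.
have -> : F = \sum_(i < m) \sum_(j < m) (fun w => F w i j *: delta_mx i j).
  apply/funext => w; rewrite [LHS]matrix_sum_delta fct_sumE.
  by apply: eq_bigr => i _; rewrite fct_sumE.
apply: differentiable_sum => i; apply: differentiable_sum => j.
exact: differentiableZl.
Qed.

End Differentiability.

(** * The denominator has no zeros in the poly-half-plane *)

Section Stability.
Variable R : realType.
Local Notation C := R[i].

Definition set_coord d (z : 'I_d -> C) (k : 'I_d) (s : C) : 'I_d -> C :=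
  fun j => if j == k then s else z j.

Lemma meval_row d (v : 'I_d -> C) (p : mpoly d C) :
  meval ((\row_k v k) 0) p = meval v p.
Proof. by apply: meval_eq => k; rewrite mxE. Qed.

Lemma near_row d (v : 'I_d -> C) (A : set 'rV[C]_d) :
  nbhs (\row_k v k) A -> exists2 e : C, 0 < e &
    forall w, (forall k, `|w k - v k| < e) -> A (\row_k w k).
Proof.
move=> /nbhs_ballP[e /= e0 eA]; exists e => // w wv; apply: eA.
split=> // i k; rewrite !mxE -ball_normE /= distrC; exact: wv.
Qed.

Section Fibre.
Variables (n : nat) (q : mpoly n.+1 C).

Definition fibre (y : 'I_n -> C) : {poly C} := map_poly (meval y) (muni q).

(** Continuity of roots: without a root near [x], the growth bound would make
    [fibre y'] as small at [x + t] as it is at [x], while these values are close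
    to those of [fibre y], which does not vanish at [x + t]. *)
Lemma root_persistence (y : 'I_n -> C) (x e : C) : 0 < e ->
    fibre y != 0 -> (fibre y).[x] = 0 ->
  exists2 del : C, 0 < del & forall y', (forall k, `|y' k - y k| < del) ->
    exists2 s, `|s - x| < e & (fibre y').[s] = 0.
Proof.
move=> e0 Fy0 Fyx.
have [t Ft] : exists t, (fibre y).[x + t] != 0.
  apply: contrapT => /forallNP Ft; move/negP: Fy0; apply; apply/eqP.
  apply: (@line_dense_ball _ x 1 ltr01) => s _; apply/eqP/negPn/negP.
  by move: (Ft (s - x)); rewrite addrC subrK.
(* the size of [muni q] bounds the degrees of all the fibres at once *)
pose M := (1 + `|t| / e) ^+ size (muni q).
have g1 : 1 <= 1 + `|t| / e by rewrite lerDl divr_ge0 // ltW.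
have M0 : 0 < M by rewrite exprn_gt0 // (lt_le_trans ltr01).
(* at a fixed [s] the fibre is polynomial, hence continuous, in [y'] *)
have FE s y' : (fibre y').[s] = meval y' (muni q).[mpolyC n s].
  by rewrite /fibre -[in LHS](mevalC y' s) horner_map.
pose a := (muni q).[mpolyC n (x + t)]; pose b := (muni q).[mpolyC n x].
set eta := `|(fibre y).[x + t]|; have eta0 : 0 < eta by rewrite normr_gt0.
have /cvgrPdist_lt /(_ (eta / 2)) := @continuous_meval R n a (\row_k y k).
move=> /(_ (divr_gt0 eta0 (ltr0n _ 2))) near_a.
have /cvgrPdist_lt /(_ (eta / 2 / M)) := @continuous_meval R n b (\row_k y k).
move=> /(_ (divr_gt0 (divr_gt0 eta0 (ltr0n _ 2)) M0)) near_b.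
have [del del0 near_y] := near_row (filterI near_a near_b).
exists del => // y' /near_y []; rewrite !meval_row -!FE Fyx sub0r normrN.
move=> lta ltb; apply: contrapT => noroot.
have grow : eta / 2 < `|(fibre y').[x + t]|.
  have := le_lt_trans (lerB_dist _ _) lta.
  by rewrite -/eta ltrBlDr {1}(splitr eta) ltrD2l.
have : `|(fibre y').[x + t]| <= `|(fibre y').[x]| * M.
  apply: le_trans (@no_root_growth _ (fibre y') x e t e0 _) _.
    by move=> s sx; apply/eqP => Fs; apply: noroot; exists s.
  by apply: ler_wpM2l => //; apply: ler_weXn2l => //; exact: size_poly.
move=> /(lt_le_trans grow); rewrite -ltr_pdivrMr // => /lt_trans/(_ ltb).
by rewrite ltxx.
Qed.

End Fibre.

Lemma fibre_setcoord n (q : mpoly n.+1 C) (v : 'I_n.+1 -> C) (s : C) :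
  (fibre q (v \o widen_ord (leqnSn n))).[s] = meval (set_coord v ord_max s) q.
Proof.
rewrite -meval_muni /fibre {2}/set_coord eqxx; congr (map_poly (meval _) _).[_].
apply/funext => k; rewrite /set_coord /= ifN //.
by rewrite -val_eqE /= neq_ltn ltn_ord.
Qed.

(** If no coordinate of any zero could be moved off the zero set, changing the
    coordinates one by one would carry a zero to every point of the
    poly-half-plane. *)
Lemma movable_zero d (q : mpoly d C) (z : 'I_d -> C) :
    q != 0 -> (forall k, 0 < 'Im (z k)) -> meval z q = 0 ->
  exists w k s, [/\ forall j, 0 < 'Im (w j), meval w q = 0 &
    meval (set_coord w k s) q != 0].
Proof.
move=> q0 zz qz; apply: contrapT => nomove.
have move0 w k s : (forall j, 0 < 'Im (w j)) -> meval w q = 0 ->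
    meval (set_coord w k s) q = 0.
  move=> ww qw; apply/eqP; apply/negPn/negP => qs.
  by apply: nomove; exists w, k, s.
move/eqP: q0; apply; apply: (@mpoly_eq0_grid _ _ (fun=> fun s => 0 < 'Im s)).
  by move=> _; exact: line_dense_upper.
(* [h i] has its first [i] coordinates from [w], the others from [z] *)
move=> w ww; pose h i (k : 'I_d) := if (k < i)%N then w k else z k.
have hh i k : 0 < 'Im (h i k) by rewrite /h; case: ifP.
have h0 i : (i <= d)%N -> meval (h i) q = 0.
  elim: i => [|i IH] id.
    by rewrite -[RHS]qz; apply: meval_eq => k; rewrite /h.
  have <- := move0 (h i) (Ordinal id) (w (Ordinal id)) (hh i) (IH (ltnW id)).
  apply: meval_eq => k; rewrite /h /set_coord ltnS leq_eqVlt -val_eqE /=.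
  by case: eqP => //= ki; congr w; apply: val_inj.
by rewrite -[RHS](h0 d (leqnn d)); apply: meval_eq => k; rewrite /h ltn_ord.
Qed.

(** If [q] had a zero, permute the variables so that it can be moved in the last
    one. By persistence of roots, [q] and all [p i] then have a common zero
    above every point of a polydisc in the other variables. Elimination either yields
    a common factor or a nonzero polynomial vanishing on that polydisc. *)
Lemma coprime_neq0 d (q : mpoly d C) (I : eqType) (r : seq I)
    (p : I -> mpoly d C) :
    q != 0 ->
    (forall g : mpoly d C, mpdvd g q ->
       (forall i, i \in r -> mpdvd g (p i)) -> exists c, g = mpolyC d c) ->
    (forall z, (forall k, 0 < 'Im (z k)) -> meval z q = 0 ->
       forall i, i \in r -> meval z (p i) = 0) ->
  forall z, (forall k, 0 < 'Im (z k)) -> meval z q != 0.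
Proof.
move=> q0 cop qp z zz; apply/eqP => qz.
have [{qz zz}w [k [s [ww qw qs]]]] := movable_zero q0 zz qz.
case: d q p q0 cop qp z w k ww qw qs => [|n] q p q0 cop qp z w k ww qw qs.
  by case: k qs.
pose sg : 'S_n.+1 := tperm k ord_max.
have sgK : involutive sg by move=> i; rewrite /sg tpermK.
have msK (u : mpoly n.+1 C) : msym sg (msym sg u) = u.
  by rewrite -msymMm /sg tperm2 msym1m.
pose q' := msym sg q; pose p' i := msym sg (p i).
have q'0 : q' != 0.
  by apply: contraNneq q0 => q'0; rewrite -(msK q) -/q' q'0 rmorph0.
have m0 (u : mpoly n.+1 C) : muni u = 0 -> u = 0.
  by move=> u0; rewrite -(muniK u) u0 rmorph0.
pose S := muni q' :: [seq muni (p' i) | i <- r].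
have qS : muni q' \in S by rewrite mem_head.
have mq0 : muni q' != 0 by apply: contraNneq q'0 => /m0 ->.
have [[g gU gS]|[c c0 cS]] := elimination (mpoly_factorial n C) qS mq0.
  (* a nonunit common factor, carried back to the original variables *)
  pose g' := msym sg (muni_inv n C g).
  have dvd u : divides g (muni (msym sg u)) -> mpdvd g' u.
    move=> [v ev]; exists (msym sg (muni_inv n C v)).
    have eu : msym sg u = muni_inv n C (v * g) by rewrite -ev muniK.
    by rewrite -[LHS]msK eu rmorphM [LHS]rmorphM.
  have [||c ec] := cop g'.
  - exact/dvd/gS.
  - move=> i ri; apply/dvd/gS; rewrite in_cons; apply/orP; right.
    by apply/mapP; exists i.
  have eg : g = (mpolyC n c)%:P.
    rewrite -[g]muni_invK -(msK (muni_inv n C g)) -/g' ec.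
    by rewrite /msym mmapC muniC.
  move/negP: gU; apply; rewrite eg; do 2!apply: rmorph_unit.
  rewrite unitfE; apply: contraNneq mq0 => c00.
  have [v ev] := gS _ qS.
  by rewrite ev eg c00 !raddf0 mulr0.
(* otherwise [c] would vanish on the polydisc over which roots persist *)
pose w' := w \o sg.
have w'w j : 0 < 'Im (w' j) by rewrite /w' /=.
have ev_sg (v : 'I_n.+1 -> C) (u : mpoly n.+1 C) :
  meval v (msym sg u) = meval (v \o sg) u := meval_msym sg u v.
pose wd := widen_ord (leqnSn n).
have qw' : (fibre q' (w' \o wd)).[w' ord_max] = 0.
  rewrite /fibre meval_muni ev_sg -[RHS]qw; apply: meval_eq => j.
  by rewrite /w' /= sgK.
have Fw' : fibre q' (w' \o wd) != 0.
  apply: contraNneq qs => F0; have := horner0 s.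
  rewrite -F0 fibre_setcoord ev_sg => <-; apply/eqP/meval_eq => j.
  rewrite /set_coord /w' /= sgK.
  by rewrite -(inj_eq (inv_inj sgK) _ k) {2}/sg tpermL.
have [e e0 eP] := root_persistence (w'w ord_max) Fw' qw'.
move/eqP: c0; apply.
apply: (@mpoly_eq0_grid _ _ (fun k t => `|t - w' (wd k)| < e /\ 0 < 'Im t)).
  by move=> j; apply: line_dense_upper_ball.
move=> y yP; have [j|t te Ft] := eP y; first by case: (yP j).
pose phi : {rmorphism {poly mpoly n C} -> C} :=
  horner_eval t \o map_poly (meval y).
suff : phi c%:P = 0 by rewrite /phi /= /horner_eval map_polyC hornerC.
apply: cS => u; rewrite in_cons => /orP[/eqP ->|/mapP[i ir ->]].
  exact: Ft.
pose v := snoc_point y t.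
have phiE (f : mpoly n.+1 C) : phi (muni f) = meval v f.
  by rewrite -meval_muni /v snoc_point_max snoc_point_widen.
rewrite phiE /p' ev_sg; apply: qp => //.
  move=> j; rewrite /=; have [->|[l ->]] := ord_widen_max (sg j).
    by rewrite /v snoc_point_max; apply: Im_gt0_ball te.
  by rewrite -[v _]/((v \o wd) l) snoc_point_widen; case: (yP l).
by rewrite -ev_sg -/q' -phiE; exact: Ft.
Qed.

(** Where [q] vanishes, so does [P], by continuity of [f]: otherwise
    [f * q - P], which is zero off the zeros of [q], would be nonzero on a
    polydisc, and [q] would vanish on it. *)
Lemma denominator_stable d m (f : 'rV[C]_d -> 'M[C]_m)
    (P : 'M[mpoly d C]_m) (q : mpoly d C) :
    (forall z, upper_halfplane z -> differentiable f z) ->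
    is_quotient f P q -> coprime_mx P q ->
  forall z : 'I_d -> C, (forall k, 0 < 'Im (z k)) -> meval z q != 0.
Proof.
move=> df [q0 fPq] cop.
pose p (ij : 'I_m * 'I_m) := P ij.1 ij.2.
apply: (@coprime_neq0 _ _ _ (index_enum ('I_m * 'I_m)%type) p q0).
  move=> g gq gP; apply: cop => // i j; apply: (gP (i, j)).
  by rewrite mem_index_enum.
move=> z zz qz [i j] _; apply/eqP/negPn/negP => pz.
pose G (w : 'rV[C]_d) := f w i j * meval (w 0) q - meval (w 0) (P i j).
have dG : differentiable G (\row_k z k).
  apply: differentiableB; last exact: differentiable_meval.
  apply: differentiableM; last exact: differentiable_meval.
  apply: (differentiable_comp (g := fun A : 'M[C]_m => A i j)).
    by apply: df => k; rewrite mxE.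
  exact: differentiable_coord.
have Gz : 0 < `|G (\row_k z k)|.
  by rewrite /G !meval_row qz mulr0 sub0r normrN normr_gt0.
have /cvgrPdist_lt /(_ _ Gz) near_G := differentiable_continuous dG.
have [e e0 eP] := near_row near_G.
move/eqP: q0; apply.
apply: (@mpoly_eq0_grid _ _ (fun k t => `|t - z k| < e)).
  by move=> k; apply: line_dense_ball.
move=> w /eP; rewrite /G; set x := \row_k w k; apply: contraTeq => qw.
rewrite -(meval_row w) -/x in qw.
rewrite [f x](fPq x qw) !mxE mulrAC mulVf // mul1r subrr subr0.
by rewrite ltxx.
Qed.

End Stability.

(** * Matrix values and the extended function *)

Lemma conj_extension (K : numClosedFieldType) (z0 a b : K) : z0^* = z0 ->
  (z0 * ((a - b^*) / (2 * 'i)) + (a + b^*) / 2)^* =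
  z0 * ((b - a^*) / (2 * 'i)) + (b + a^*) / 2.
Proof.
move=> z0r; rewrite rmorphD !rmorphM !fmorphV !rmorphM /= conjC_nat conjCi z0r.
rewrite rmorphB rmorphD /= conjCK.
by field; rewrite neq0Ci.
Qed.

Section MatrixPart.
Variable R : realType.
Local Notation C := R[i].

Definition quad m (v : 'cV[C]_m) (A : 'M[C]_m) : C := (v ^t* *m A *m v) 0 0.

Lemma quadD m (v : 'cV[C]_m) A B : quad v (A + B) = quad v A + quad v B.
Proof. by rewrite /quad mulmxDr mulmxDl mxE. Qed.

Lemma quadZ m (v : 'cV[C]_m) a A : quad v (a *: A) = a * quad v A.
Proof. by rewrite /quad -scalemxAr -scalemxAl mxE. Qed.

Lemma quadB m (v : 'cV[C]_m) A B : quad v (A - B) = quad v A - quad v B.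
Proof. by rewrite -scaleN1r quadD quadZ mulN1r. Qed.

Lemma quad_adj m (v : 'cV[C]_m) A : quad v (A ^t*) = (quad v A)^*.
Proof.
have -> : (quad v A)^* = ((v ^t* *m A *m v) ^t*) 0 0.
  by rewrite [RHS]mxE; congr (_^*); rewrite [RHS]mxE.
by rewrite /quad !trmx_mul !map_mxM /= trmxCK mulmxA.
Qed.

Lemma quad_imag m (v : 'cV[C]_m) A :
  quad v ((2 * 'i)^-1 *: (A - A ^t*)) = 'Im (quad v A).
Proof.
rewrite quadZ quadB quad_adj ImE invfM invCi.
by ring.
Qed.

Lemma psd_imagP m (A : 'M[C]_m) :
  psdmx ((2 * 'i)^-1 *: (A - A ^t*)) <-> forall v, 0 <= 'Im (quad v A).
Proof.
split=> [[_ Apsd] v|Apsd]; first by rewrite -quad_imag; exact: Apsd.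
split; last by move=> v; have := Apsd v; rewrite -quad_imag.
apply/is_hermitianmxP; rewrite expr0 scale1r; apply/matrixP => i j.
rewrite !mxE rmorphM rmorphB /= conjCK fmorphV rmorphM /= conjCi conjC_nat.
by rewrite mulrN invrN mulNr -mulrN opprB.
Qed.

(** The polynomial [v^* P v], which reduces positivity to the scalar case. *)
Definition quad_poly d m (v : 'cV[C]_m) (P : 'M[mpoly d C]_m) : mpoly d C :=
  \sum_i \sum_j ((v i 0)^* * v j 0) *: P i j.

Lemma meval_quad_poly d m (v : 'cV[C]_m) (P : 'M[mpoly d C]_m) (z : 'rV[C]_d) :
  meval (z 0) (quad_poly v P) = quad v (mpmx_eval P z).
Proof.
rewrite /quad_poly raddf_sum /= /quad mxE.
under [RHS]eq_bigr do rewrite mxE mulr_suml.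
rewrite [RHS]exchange_big /=; apply: eq_bigr => i _.
rewrite raddf_sum; apply: eq_bigr => j _.
by rewrite !mxE [LHS]mevalZ mulrAC.
Qed.

Definition conj_row d (z : 'rV[C]_d) : 'rV[C]_d := map_mx Num.conj z.

Lemma reflect_evalE d (p : mpoly d C) (z : 'rV[C]_d) :
  (meval (conj_row z 0) p)^* = reflect_eval p (z 0).
Proof. by congr (_^*); apply: meval_eq => k; rewrite mxE. Qed.

Definition shift_vars d : mpoly d C -> mpoly (1 + d) C :=
  mmap (@mpolyC (1 + d) C) (fun k => mpolyX C (mnm1 (rshift 1 k))).

Lemma meval_shift_vars d (p : mpoly d C) (w : 'I_(1 + d) -> C) :
  meval w (shift_vars p) = meval (fun k => w (rshift 1 k)) p.
Proof.
pose phi : {rmorphism mpoly d C -> C} := meval w \o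
  mmap (@mpolyC (1 + d) C) (fun k => mpolyX C (mnm1 (rshift 1 k))).
apply: (mpoly_rmorph_eq (f := phi) (g := meval _)) => [c|i]; rewrite /phi /=.
  by rewrite mmapC !mevalC.
by rewrite mmapX mmap1U !mevalXU.
Qed.

Lemma meval_conj d (p : mpoly d C) (z : 'I_d -> C) :
  meval z (map_mpoly Num.conj p) = reflect_eval p z.
Proof.
apply: (canRL conjCK); pose phi : {rmorphism mpoly d C -> C} :=
  (@Num.conj C) \o meval z \o map_mpoly (@Num.conj C).
apply: (mpoly_rmorph_eq (f := phi) (g := meval _)) => [c|i]; rewrite /phi /=.
  by rewrite map_mpolyC !mevalC conjCK.
by rewrite map_mpolyX !mevalXU.
Qed.

(** The extension is a polynomial in all the variables, which gives both the
    rationality and the differentiability of [g]; it is characterised by its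
    values. *)
Lemma extend_poly_sig d (a b : mpoly d C) :
  {E : mpoly (1 + d) C | forall w, meval w E =
     extend_eval a b (w (lshift d 0)) (fun k => w (rshift 1 k))}.
Proof.
have meval_affine w c c' (x a' b' : mpoly (1 + d) C) y s t :
    meval w x = y -> meval w a' = s -> meval w b' = t ->
    meval w (x * ((a' - b') * mpolyC (1 + d) c) +
             (a' + b') * mpolyC (1 + d) c') =
      y * ((s - t) * c) + (s + t) * c'.
  by move=> <- <- <-; rewrite mevalD !mevalM !mevalC mevalB mevalD.
pose a' := shift_vars a; pose b' := shift_vars (map_mpoly Num.conj b).
pose z0 : mpoly (1 + d) C := mpolyX C (mnm1 (lshift d 0)).
exists (z0 * ((a' - b') * mpolyC (1 + d) (2 * 'i)^-1) +
        (a' + b') * mpolyC (1 + d) 2^-1) => w.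
apply: meval_affine; first exact: mevalXU; first exact: meval_shift_vars.
exact: etrans (meval_shift_vars _ w) (meval_conj b _).
Qed.

Definition extend_poly d (a b : mpoly d C) : mpoly (1 + d) C :=
  sval (extend_poly_sig a b).

Lemma meval_extend_poly d (a b : mpoly d C) (w : 'rV[C]_(1 + d)) :
  meval (w 0) (extend_poly a b) =
  extend_eval a b (lsubmx w 0 0) (rsubmx w 0).
Proof.
rewrite [LHS](svalP (extend_poly_sig a b)) mxE; congr extend_eval.
by apply/funext => k; rewrite mxE.
Qed.

Lemma null_set_empty d (A : set 'rV[R]_(1 + d)) :
  (forall x, ~ A x) -> Defs.null_set A.
Proof.
move=> A0 e e0; exists (fun=> 0), (fun=> 0); split.
- by move=> n k; rewrite !mxE.
- by move=> x /A0.
- rewrite eseries0 ?lee_fin ?ltW // => n _ _.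
  by rewrite big_ord_recl mxE subrr mul0r.
Qed.

End MatrixPart.

Theorem theorem3p1 (R : realType) (d m : nat)
    (f : 'rV[R[i]]_d -> 'M[R[i]]_m)
    (P : 'M[mpoly d R[i]]_m) (q : mpoly d R[i])
    (f_pick : pick_class f) (fPq : is_quotient f P q)
    (coprimePq : coprime_mx P q) :
  let Pv (z : 'rV[R[i]]_d) : 'M[R[i]]_m := mpmx_eval P z in
  let qv (z : 'rV[R[i]]_d) : R[i] := meval (z 0) q in
  let cj (z : 'rV[R[i]]_d) : 'rV[R[i]]_d := map_mx Num.conj z in
  let P1 (z : 'rV[R[i]]_d) := (2 * 'i)^-1 *: (Pv z - (Pv (cj z)) ^t*) in
  let P2 (z : 'rV[R[i]]_d) := 2^-1 *: (Pv z + (Pv (cj z)) ^t*) in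
  let q1 (z : 'rV[R[i]]_d) := (qv z - (qv (cj z))^*) / (2 * 'i) in
  let q2 (z : 'rV[R[i]]_d) := (qv z + (qv (cj z))^*) / 2 in
  let g (z0 : R[i]) (z : 'rV[R[i]]_d) : 'M[R[i]]_m :=
    (z0 * q1 z + q2 z)^-1 *: (z0 *: P1 z + P2 z) in
  inner_pick_class
    (fun w : 'rV[R[i]]_(1 + d) => g (lsubmx w 0 0) (rsubmx w)) /\
  (forall z, upper_halfplane z \/ qv z != 0 -> g 'i z = f z).
Proof.
move=> Pv qv cj P1 P2 q1 q2 g.
have [f_diff f_psd] := f_pick.
have q_stable := denominator_stable f_diff fPq coprimePq.
have DE z0 z : z0 * q1 z + q2 z = extend_eval q q z0 (z 0).
  by rewrite /q1 /q2 /qv reflect_evalE.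
have NE v z0 z : quad v (z0 *: P1 z + P2 z) =
    extend_eval (quad_poly v P) (quad_poly v P) z0 (z 0).
  rewrite /P1 /P2 /Pv quadD quadZ !quadZ quadB quadD quad_adj.
  rewrite -!meval_quad_poly reflect_evalE /extend_eval.
  by ring.
have fE v (z : 'I_d -> R[i]) : (forall k, 0 < 'Im (z k)) ->
    meval z (quad_poly v P) / meval z q = quad v (f (\row_k z k)).
  move=> zz; have [_ ->] := fPq; rewrite meval_row ?q_stable //.
  by rewrite quadZ -meval_quad_poly meval_row mulrC.
pose gw (w : 'rV[R[i]]_(1 + d)) := g (lsubmx w 0 0) (rsubmx w).
have gwE w : gw w = (meval (w 0) (extend_poly q q))^-1 *:
    mpmx_eval (\matrix_(i, j) extend_poly (P i j) (P j i)) w.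
  rewrite meval_extend_poly -DE /gw /g; congr (_ *: _).
  apply/matrixP => i j; rewrite !mxE meval_extend_poly /extend_eval.
  rewrite -reflect_evalE [(2 * 'i)^-1 * _]mulrC [2^-1 * _]mulrC.
  by rewrite [lsubmx w 0 0]mxE.
have upperD (w : 'rV[R[i]]_(1 + d)) : upper_halfplane w ->
   lsubmx w 0 0 * q1 (rsubmx w) + q2 (rsubmx w) != 0.
  move=> ww; rewrite DE; apply: extend_eval_neq0 => //.
    by rewrite mxE; exact: ww.
  by move=> k; rewrite mxE; exact: ww.
split; last first.
  move=> z zq; have qz : qv z != 0.
    by case: zq => // zz; apply: q_stable.
  have [_ ->] := fPq; last exact: qz.
  rewrite /g; congr (_^-1 *: _).
    by rewrite /q1 /q2; field; rewrite neq0Ci.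
  apply/matrixP => i j; rewrite /P1 /P2 !mxE.
  by field; rewrite neq0Ci.
split.
- split=> w ww.
    apply: differentiable_mx => i j.
    have -> : (fun w => gw w i j) =
        (fun w => (meval (w 0) (extend_poly q q))^-1) *
        (fun w => meval (w 0) (extend_poly (P i j) (P j i))).
      by apply/funext => u; rewrite gwE !mxE.
    apply: differentiableM; last exact: differentiable_meval.
    apply: differentiableV; first exact: differentiable_meval.
    by rewrite meval_extend_poly -DE; exact: upperD.
  apply/psd_imagP => v; rewrite quadZ DE NE mulrC.
  apply: Im_extend_eval_ge0 => //.
  + move=> z zz; rewrite fE //.
    by apply: (psd_imagP _).1; apply: f_psd => k; rewrite mxE.
  + by rewrite mxE; exact: ww.
  + by move=> k; rewrite mxE; exact: ww.
- exists (\matrix_(i, j) extend_poly (P i j) (P j i)), (extend_poly q q).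
  split=> [|w _]; last exact: gwE.
  have /upperD : upper_halfplane (const_mx 'i : 'rV[R[i]]_(1 + d)).
    by move=> k; rewrite mxE Im_i ltr01.
  rewrite DE -meval_extend_poly; apply: contraNneq => ->.
  by rewrite meval0.
(* where the denominator vanishes the value is [0], which is Hermitian *)
- apply: null_set_empty => x /negP; apply.
  set z0 := lsubmx _ 0 0; set z := rsubmx _.
  have z0r : z0^* = z0 by rewrite /z0 !mxE; exact: conjc_real.
  have zr : cj z = z.
    by apply/rowP => k; rewrite !mxE; exact: conjc_real.
  rewrite /g /q1 /q2 /P1 /P2 zr; apply/is_hermitianmxP.
  rewrite expr0 scale1r; apply/matrixP => i j; rewrite !mxE.
  rewrite rmorphM fmorphV [(2 * 'i)^-1 * _]mulrC [2^-1 * _]mulrC.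
  rewrite [(2 * 'i)^-1 * _]mulrC [2^-1 * (_ + _)]mulrC.
  by rewrite /= !conj_extension.
Qed.
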